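(* For the particular choice $\Xi=\operatorname{diag}(\Xi_1,\dots,\Xi_d)$ with $\Xi_i=\Xi^i\mathcal B^{[i]}$, the mass term $\mathcal M$ is of the form $$\langle\mathcal M,M_1(z_1)\otimes\overline{M_2(z_2)}\rangle=\Big\langle\sum_{i=1}^d\sum_{l=0}^{m_i-1}\Xi^i_l\frac{(-1)^l}{l!}\delta^{(l)}(z-\zeta_i),\,M_1(z)M_{2,*}(z)\Big\rangle$$ for Laurent polynomials $M_1,M_2$.
   Context: $L(z)=L_nz^{-n}\prod_{i=1}^d(z-\zeta_i)^{m_i}$ is a Laurent polynomial with $L_n\neq0$, distinct zeros $\zeta_1,\dots,\zeta_d\in\mathbb C\setminus\{0\}$ of multiplicities $m_1,\dots,m_d$, and $m_1+\dots+m_d=2n$. For a Laurent polynomial $M$, its reciprocal is $M_*(z):=\bar M(z^{-1})=\overline{M(\bar z^{-1})}$, and $M_{2,*}:=(M_2)_*$. The derivatives of the delta functional act by $\langle\delta^{(l)}(z-\zeta),f(z)\rangle=(-1)^lf^{(l)}(\zeta)$. For a matrix $\Xi=(\Xi_{i,k|j,l})\in\mathbb C^{2n\times2n}$, with rows indexed by $(i,k)$ ($1\le i\le d$, $0\le k\le m_i-1$) and columns by $(j,l)$ ($1\le j\le d$, $0\le l\le m_j-1$), the mass term is the bivariate linear functional $$\mathcal M=\sum_{i,j=1}^d\sum_{k=0}^{m_i-1}\sum_{l=0}^{m_j-1}\frac{(-1)^{k+l}}{k!\,l!}\,\Xi_{i,k|j,l}\,\delta^{(k)}(z_1-\zeta_i)\otimes\overline{\delta^{(l)}\big(z_2-(\bar\zeta_j)^{-1}\big)},$$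 so that $$\langle\mathcal M,M_1(z_1)\otimes\overline{M_2(z_2)}\rangle=\sum_{i,j=1}^d\sum_{k=0}^{m_i-1}\sum_{l=0}^{m_j-1}\frac{1}{k!\,l!}\,\Xi_{i,k|j,l}\,M_1^{(k)}(\zeta_i)\,\overline{M_2^{(l)}\big((\bar\zeta_j)^{-1}\big)}.$$ $\Xi=\operatorname{diag}(\Xi_1,\dots,\Xi_d)$ means block diagonal: $\Xi_{i,k|j,l}=0$ for $i\ne j$, and $\Xi_{i,k|i,l}$ is the $(k,l)$ entry of the $m_i\times m_i$ block $\Xi_i$ (indices starting at $0$). For $1\le j\le k$, $$\mathcal B^{[i]}_{k,j}:=(-1)^k\sum\frac{k!}{j_1!\cdots j_{k-j+1}!}(\zeta_i)^{-k-j},$$ the sum running over nonnegative integers $j_1,\dots,j_{k-j+1}$ with $j_1+j_2+\dots+j_{k-j+1}=j$ and $j_1+2j_2+\dots+(k-j+1)j_{k-j+1}=k$. $\mathcal B^{[i]}$ is the $m_i\times m_i$ lower triangular matrix (indices $0,\dots,m_i-1$) with $(0,0)$ entry $1$, $(k,j)$ entry $\mathcal B^{[i]}_{k,j}$ for $1\le j\le k\le m_i-1$, and all other entries $0$. Given complex numbers $\Xi^i_l$ ($1\le i\le d$, $0\le l\le m_i-1$), $\Xi^i$ is the $m_i\times m_i$ matrix (indices $0,\dots,m_i-1$) with $(p,q)$ entry $\frac{1}{p!\,q!}\Xi^i_{p+q}$ if $p+q\le m_i-1$ and $0$ otherwise.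
   Formalization: As stated the claim fails for some m_i ≥ 3 (factorials counted twice); the theorem uses Ξ_i = D_i Ξ^i B^{[i]} D_i with D_i = diag(0!,1!,…,(m_i−1)!) instead of Ξ_i = Ξ^i B^{[i]}; for m_i ≤ 2 the two agree. *)

(* Defs.v *)
From HB Require Import structures.
From mathcomp Require Import all_boot all_order all_algebra.
From mathcomp Require Import complex.
From mathcomp Require Import all_classical all_reals all_analysis.

Set Implicit Arguments.
Unset Strict Implicit.
Unset Printing Implicit Defensive.

Import Order.TTheory GRing.Theory Num.Theory.
Import numFieldNormedType.Exports.
Local Open Scope ring_scope.

(* The complex numbers over R.  Stating the type through [numClosedFieldType]
   gives it its canonical topology, so that [derive1n] on [Cx R -> Cx R] is the
   iterated complex derivative. *)
Definition Cx (R : realType) : numClosedFieldType := R[i].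

Section MassTerm.
Variable R : realType.
Local Notation C := (Cx R).

(* Laurent polynomials as functions on the punctured plane: the value of the
   total function f at 0 is irrelevant. *)
Definition laurent (f : C -> C) : Prop :=
  exists (N : nat) (p : {poly C}), forall z, z != 0 -> f z = p.[z] / z ^+ N.

(* M_*(z) = conj (M (1 / conj z)) *)
Definition reciprocal (M : C -> C) : C -> C := fun z => (M (z^*)^-1)^*.

(* The functional delta^(l)(z - a). *)
Definition delta (l : nat) (a : C) (f : C -> C) : C :=
  (-1) ^+ l * derive1n l f a.

(* u (x) conj v, where the functional conj v is g |-> conj (v (conj g)); on
   F(z1, z2) = M1(z1) * conj (M2(z2)) with u, v linear it gives
   u(M1) * conj (v(M2)). *)
Definition tensor_conj (u v : (C -> C) -> C) (F : C -> C -> C) : C :=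
  u (fun z1 => (v (fun z2 => (F z1 z2)^*))^*).

Definition mass (d : nat) (zeta : 'I_d -> C) (m : 'I_d -> nat)
    (Xi : 'M[C]_(\sum_(i < d) m i)) (F : C -> C -> C) : C :=
  \sum_(i < d) \sum_(j < d) \sum_(k < m i) \sum_(l < m j)
    (-1) ^+ (k + l) / (k`! * l`!)%:R * submxblock Xi i j k l
    * tensor_conj (delta k (zeta i)) (delta l ((zeta j)^*)^-1) F.

(* The partial Bell polynomial of the Faa di Bruno formula for w |-> 1/w at z:
   (f(1/w))^(k) at z is the sum over j of bell z k j * f^(j)(1/z).
   The index r : 'I_(k - j + 1) stands for j_(r+1).  Since the j_r sum to j,
   bounding each of them by j loses no term. *)
Definition bell (z : C) (k j : nat) : C :=
  (-1) ^+ k *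
  \sum_(s : {ffun 'I_(k - j + 1) -> 'I_j.+1} |
        (\sum_(r < k - j + 1) s r == j)%N &&
        (\sum_(r < k - j + 1) r.+1 * s r == k)%N)
     k`!%:R / (\prod_(r < k - j + 1) (s r)`!)%:R * z ^- (k + j).

Definition bell_mx (z : C) (mi : nat) : 'M[C]_mi :=
  \matrix_(k, j) (if j == 0 :> nat then (k == 0 :> nat)%:R
                  else if (j <= k)%N then bell z k j else 0).

(* xi 0, ..., xi (mi - 1) are the only values used. *)
Definition hankel_mx (xi : nat -> C) (mi : nat) : 'M[C]_mi :=
  \matrix_(p, q) (if (p + q < mi)%N then xi (p + q)%N / (p`! * q`!)%:R else 0).

(* diag (0!, 1!, ..., (mi - 1)!).  [mass] weights the (k, l) entry by
   1 / (k! l!), whereas hankel_mx *m bell_mx holds the coefficients of the plain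
   derivatives M1^(k), M2^(l), the factorials of the Leibniz rule being already
   in hankel_mx.  Multiplying by fact_mx on both sides reconciles the two
   normalizations; fact_mx is the identity matrix when mi <= 2. *)
Definition fact_mx (mi : nat) : 'M[C]_mi := diag_mx (\row_k k`!%:R).

Definition line_mass (d : nat) (zeta : 'I_d -> C) (m : 'I_d -> nat)
    (xi : 'I_d -> nat -> C) (f : C -> C) : C :=
  \sum_(i < d) \sum_(l < m i)
    xi i l * ((-1) ^+ l / l`!%:R) * delta l (zeta i) f.

End MassTerm.

(* Main.v *)
Require Import Defs.
From HB Require Import structures.
From mathcomp Require Import all_boot all_order all_algebra.
From mathcomp Require Import complex.
From mathcomp Require Import all_classical all_reals all_analysis.
From mathcomp Require Import ring zify.

Set Implicit Arguments.
Unset Strict Implicit.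
Unset Printing Implicit Defensive.

Import Order.TTheory GRing.Theory Num.Theory.
Import numFieldNormedType.Exports.
Local Open Scope ring_scope.

(** Only the diagonal blocks contribute, so everything happens at one zero
    [z = zeta i] of multiplicity [m]. Write [h = reciprocal M2]. On the right
    stands the sum over [l < m] of [xi l / l!] times the [l]-th derivative of
    [M1 h] at [z]. The Leibniz rule turns it into the sum over [k + p < m] of
    [xi (k + p) / (k! p!)] times the [k]-th derivative of [M1] and the [p]-th
    derivative of [h]; these coefficients are the entries of [hankel_mx], whose
    triangular shape comes from the condition [l < m] ([sum_antidiagonals]).

    It remains to express the derivatives of [h] at [z] through those of [M2] at
    [1 / conj z], on which the mass term acts. Put [g w = conj (M2 (conj w))].
    Then [h w = g (1 / w)], and the conjugate of the [l]-th derivative of [M2] at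
    [1 / conj z] is the [l]-th derivative of [g] at [1 / z] ([derive1n_conj]). So
    the matrix needed is the one of the Faa di Bruno formula for composition with
    [1 / w], and [bell_mx] must be recognized as that matrix.

    Differentiating [g (1 / w)] repeatedly gives coefficients
    [(-1)^k * lah k j * w^-(k + j)], where [lah] obeys a two-term recurrence
    ([faa_di_bruno_inv]) with solution [lah k j = k!/j! * 'C(k - 1, j - 1)]
    ([lah_closed]). By the multinomial theorem, the sum over integer vectors in
    the definition of [bell] is the coefficient of [X^k] in
    [k!/j! * (X + ... + X^(k - j + 1))^j], which has the same value
    ([sum_partitions]). *)

(** * Partial Bell polynomials of the inversion and Lah numbers *)

(** The multinomial theorem in divided powers. Exponent vectors are functions into
    ['I_J.+1], so the left-hand side is a coefficient in the product of the
    exponentials of [c r *: 'X] truncated after degree [J]; truncation is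
    invisible in degrees up to [J], where exponentials multiply by the binomial
    theorem. *)
Lemma multinomial (F : numFieldType) (A : comAlgType F) (n J : nat)
    (c : 'I_n -> A) (j : nat) : (j <= J)%N ->
  \sum_(s : {ffun 'I_n -> 'I_J.+1} | (\sum_(r < n) s r == j)%N)
    \prod_(r < n) ((s r)`!%:R^-1 *: c r ^+ s r) =
  j`!%:R^-1 *: (\sum_(r < n) c r) ^+ j.
Proof.
move=> le_jJ.
have coef_prod m (e : 'I_m -> A) i : (i <= J)%N ->
    (\prod_(r < m) \sum_(a < J.+1) (a`!%:R^-1 *: e r ^+ a) *: 'X^a)`_i =
    i`!%:R^-1 *: (\sum_(r < m) e r) ^+ i.
  elim: m e i => [|m IHm] e i le_iJ.
    rewrite !big_ord0 coef1 expr0n; case: i {le_iJ} => [|i] /=.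
      by rewrite fact0 invr1 scale1r.
    by rewrite scaler0.
  rewrite [\prod_(r < m.+1) _]big_ord_recr [\sum_(r < m.+1) _]big_ord_recr /=.
  rewrite coefM [X in X ^+ i]addrC exprDn scaler_sumr.
  apply: eq_bigr => a _; have le_ai : (a <= i)%N by rewrite -ltnS.
  rewrite IHm ?(leq_trans le_ai) //.
  rewrite -(poly_def _ (fun b => b`!%:R^-1 *: e ord_max ^+ b)) coef_poly.
  rewrite ltnS (leq_trans (leq_subr _ _)) //.
  rewrite -scalerAr -scalerAl scalerA -[_ *+ 'C(_, _)](scaler_nat (R := F)).
  rewrite scalerA [X in _ *: X = _]mulrC.
  rewrite -(bin_fact le_ai) !natrM; congr (_ *: _).
  by field; rewrite !pnatr_eq0 -!lt0n !fact_gt0 bin_gt0 le_ai.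
rewrite -coef_prod // bigA_distr_bigA coef_sum big_mkcond /=.
apply: eq_bigr => s _.
rewrite (eq_bigr (fun r =>
  ((s r)`!%:R^-1 *: c r ^+ s r)%:P * 'X^(s r))); last first.
  by move=> r _; rewrite mul_polyC.
rewrite big_split /= -rmorph_prod /= prodrXr coefCM coefXn eq_sym.
by case: eqP => _; rewrite ?mulr1 ?mulr0.
Qed.

(** Below degree [N], a truncated geometric series cannot be told from the full
    one, and the coefficients of [(1 - X)^-(j + 1)] are binomial. *)
Lemma coef_geom_exp (F : numFieldType) (N e j : nat) : (e < N)%N ->
  ((\sum_(r < N) 'X^r : {poly F}) ^+ j.+1)`_e = 'C(e + j, j)%:R.
Proof.
have geomE a : (\sum_(r < N) 'X^r : {poly F})`_a = (a < N)%N%:R.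
  rewrite (eq_bigr (fun r : 'I_N => 1 *: 'X^r)) => [|r _]; last by rewrite scale1r.
  by rewrite -(poly_def _ (fun=> 1)) coef_poly; case: ltnP.
elim: j e => [|j IHj] e lt_eN; first by rewrite expr1 geomE lt_eN bin0.
rewrite exprSr coefM.
rewrite (eq_bigr (fun i : 'I_e.+1 => 'C(i + j, j)%:R)) => [|i _]; last first.
  have lt_iN : (i < N)%N by have := ltn_ord i; lia.
  have lt_eiN : (e - i < N)%N by lia.
  by rewrite IHj // geomE lt_eiN mulr1.
rewrite -natr_sum; congr _%:R.
elim: e {lt_eN} => [|e IHe]; first by rewrite big_ord_recl big_ord0 !add0n !binn.
by rewrite big_ord_recr /= IHe [in RHS]addSn binS addSnnS.
Qed.

(** The unsigned Lah numbers, defined by the recurrence that differentiating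
    [f (1 / z)] produces. *)
Fixpoint lah (k j : nat) : nat :=
  match k, j with
  | 0, 0 => 1
  | 0, _.+1 => 0
  | _.+1, 0 => 0
  | k'.+1, j'.+1 => (k' + j) * lah k' j + lah k' j'
  end.

Lemma lah_small k j : (k < j)%N -> lah k j = 0%N.
Proof.
elim: k j => [|k IHk] [|j] //= lt_kj.
by rewrite !IHk ?muln0 // ltnW.
Qed.

(** The recurrence of [lah] is Pascal's rule combined with the absorption identity
    for binomial coefficients. *)
Lemma lah_closed k j : (j.+1`! * lah k.+1 j.+1 = k.+1`! * 'C(k, j))%N.
Proof.
elim: k j => [|k IHk] j.
  by case: j => [|j] //=; rewrite bin0n /= muln0 addn0 muln0.
have -> : lah k.+2 j.+1 = ((k.+1 + j.+1) * lah k.+1 j.+1 + lah k.+1 j)%N by [].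
case: j => [|j].
  by rewrite [lah k.+1 0]/= addn0 mulnCA IHk !bin0 !muln1 addn1.
have IH1 := IHk j.+1; have IH0 := IHk j.
rewrite mulnDr mulnCA IH1 (factS j.+1) -mulnA IH0 (factS k.+1) binS.
have Hc := mul_bin_left k j.
have [le_jk|lt_kj] := leqP j k; last by rewrite !bin_small; lia.
(* The absorption identity (j + 1) C(k, j + 1) = (k - j) C(k, j), freed of its
   truncated subtraction. *)
have {}Hc : (j.+1 * 'C(k, j.+1) + j * 'C(k, j) = k * 'C(k, j))%N.
  by rewrite Hc -mulnDl subnK.
move: ('C(k, j.+1)) ('C(k, j)) Hc k.+1`! => x y Hc f; nia.
Qed.

(** Giving the variable with index [r] the value [X^(r+1)] in the multinomial
    theorem records the second condition on [s] as the exponent of [X]. *)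
Lemma sum_partitions (F : numFieldType) (k j : nat) : (0 < j <= k)%N ->
  \sum_(s : {ffun 'I_(k - j + 1) -> 'I_j.+1} |
        (\sum_(r < k - j + 1) s r == j)%N &&
        (\sum_(r < k - j + 1) r.+1 * s r == k)%N)
     k`!%:R / (\prod_(r < k - j + 1) (s r)`!)%:R = (lah k j)%:R :> F.
Proof.
case/andP; case: j => // j _; case: k => // k le_jk.
(* The largest part is N = k - j + 1: after one factor 'X is taken out of each of
   the j summands, the coefficient to be read has degree k - j < N. *)
set N := (k.+1 - j.+1 + 1)%N.
have := multinomial (fun r : 'I_N => 'X^(r.+1) : {poly F}) (leqnn j.+1).
move=> /(congr1 (fun p : {poly F} => k.+1`!%:R * p`_k.+1)).
have -> : \sum_(r < N) 'X^(r.+1) = 'X * (\sum_(r < N) 'X^r) :> {poly F}.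
  by rewrite mulr_sumr; apply: eq_bigr => r _; rewrite exprS.
rewrite coefZ exprMn coefXnM ltnNge le_jk /= coef_geom_exp; last by rewrite /N; lia.
have -> : (k.+1 - j.+1 + j)%N = k by lia.
rewrite [RHS]mulrCA -natrM -lah_closed natrM mulKf; last first.
  by rewrite pnatr_eq0 -lt0n fact_gt0.
move=> <-.
rewrite coef_sum mulr_sumr big_mkcondr /=.
apply: eq_bigr => s _.
rewrite scaler_prod prodfV natr_prod.
rewrite (eq_bigr (fun r : 'I_N => 'X^(r.+1 * s r))); last by move=> r _; rewrite exprM.
rewrite prodrXr coefZ coefXn eq_sym.
by case: eqP => _; rewrite ?mulr1 ?mulr0.
Qed.

(** * Derivatives of Laurent polynomials off zero *)

Lemma is_derive1_chain (K : numFieldType) (f g : K -> K) (x a b : K) :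
  is_derive (g x) 1 f a -> is_derive x 1 g b -> is_derive x 1 (f \o g) (a * b).
Proof.
move=> [df <-{a}] [dg <-{b}].
have dfd : differentiable f (g x) by apply/derivable1_diffP.
have dgd : differentiable g x by apply/derivable1_diffP.
apply: DeriveDef; first by apply/derivable1_diffP/differentiable_comp.
rewrite -!derive1E derive1E'; last exact: differentiable_comp.
rewrite diff_comp // !derive1E' //= -[X in 'd  _ _ X = _]mulr1.
by rewrite [LHS]linearZ mulrC.
Qed.

Lemma is_derive1_inv (K : numFieldType) (z : K) : z != 0 ->
  is_derive z 1 (fun w : K => w^-1) (- z ^- 2).
Proof.
move=> z0.
have dz : derivable (fun w : K => w^-1) z 1 by apply: derivableV.
apply: DeriveDef => //.
by rewrite (@deriveV _ _ id) // derive_id [LHS]mulr1.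
Qed.

Lemma is_derive1_exprN (K : numFieldType) (N : nat) (z : K) : z != 0 ->
  is_derive z 1 (fun w : K => w ^- N) (- (N%:R * z ^- N.+1)).
Proof.
move=> z0; have Xz : is_derive z 1 (fun w : K => w ^+ N) (N%:R * z ^+ N.-1).
  have -> : (fun w : K => w ^+ N) = id ^+ N by apply/funext => w; rewrite exprfctE.
  by apply: is_derive_eq; rewrite [LHS]mulr1.
have zN0 : z ^+ N != 0 by rewrite expf_neq0.
have dV := is_derive1_chain (g := fun w => w ^+ N) (x := z)
  (is_derive1_inv zN0) Xz.
apply: (is_derive_eq dV).
case: N {Xz zN0 dV} => [|N]; first by rewrite !mul0r mulr0 oppr0.
by rewrite [N.+1.-1]/= !exprS; field; rewrite ?expf_neq0 z0.
Qed.

Lemma is_derive1_horner (K : numFieldType) (p : {poly K}) (z : K) :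
  is_derive z 1 (horner p) p^`().[z].
Proof.
elim/poly_ind: p => [|p c IHp].
  rewrite deriv0 horner0; have -> : horner (0 : {poly K}) = cst 0.
    by apply/funext => w; rewrite horner0.
  exact: is_derive_cst.
have -> : horner (p * 'X + c%:P) = (horner p * id) + cst c.
  by apply/funext => w; rewrite !hornerE.
apply: is_derive_eq; rewrite derivD derivC derivM derivX !hornerE.
by rewrite addrC mulrC [_%:A]mulr1.
Qed.

Section OffZero.
Variable R : realType.
Local Notation C := (Cx R).

Lemma near_neq0 (z : C) : z != 0 -> \forall w \near z, w != 0.
Proof.
move=> z0; apply/nbhs_ballP; exists `|z|; first by rewrite /= normr_gt0.
move=> w; rewrite -ball_normE /= => lt_wz.
by apply: contraTneq lt_wz => ->; rewrite subr0 ltxx.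
Qed.

(** Keeping the exponent and the numerator explicit makes differentiation an
    operation on such pairs, given on numerators by [deriv_num]; conjugation acts
    on them as well, through the coefficients. *)
Definition laurent_of (N : nat) (p : {poly C}) (f : C -> C) : Prop :=
  forall z, z != 0 -> f z = p.[z] / z ^+ N.

Definition deriv_num (N : nat) (p : {poly C}) : {poly C} :=
  p^`() * 'X - p *+ N.

Lemma is_derive1_laurent_of N p (f : C -> C) (z : C) :
  laurent_of N p f -> z != 0 ->
  is_derive z 1 f ((deriv_num N p).[z] / z ^+ N.+1).
Proof.
move=> fE z0; apply: (@near_eq_is_derive _ _ _ (horner p * (fun w => w ^- N))).
  near=> w; rewrite fE //; near: w; exact: near_neq0.
have hp := is_derive1_horner p z; have hN := is_derive1_exprN N z0.
apply: (is_derive_eq (is_deriveM hp hN)).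
rewrite /deriv_num !hornerE /GRing.scale /= !exprS hornerMn -mulr_natr.
by field; rewrite expf_neq0 z0.
Unshelve. all: by end_near. Qed.

Lemma laurent_of_derive1 N p (f : C -> C) : laurent_of N p f ->
  laurent_of N.+1 (deriv_num N p) (derive1 f).
Proof.
by move=> fE z z0; have [_ <-] := is_derive1_laurent_of fE z0; rewrite derive1E.
Qed.

Lemma laurent_derive1n k (f : C -> C) : laurent f -> laurent (derive1n k f).
Proof.
move=> Lf; elim: k => [//|k [N [p fE]]].
by exists N.+1, (deriv_num N p); rewrite derive1nS; exact: laurent_of_derive1.
Qed.

(** A Laurent polynomial is smooth off 0, so iterated derivatives there may be
    computed with the rules of calculus. *)
Lemma is_derive1n k (f : C -> C) (z : C) : laurent f -> z != 0 ->
  is_derive z 1 (derive1n k f) (derive1n k.+1 f z).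
Proof.
move=> /(laurent_derive1n k) [N [p fE]] z0.
have df := is_derive1_laurent_of fE z0; apply: (is_derive_eq df).
by rewrite derive1nS derive1E; case: df => _ ->.
Qed.

Lemma laurent_of_conj N p (f g : C -> C) : laurent_of N p f ->
  (forall w, w != 0 -> g w = (f w^*)^*) ->
  laurent_of N (map_poly Num.conj p) g.
Proof.
move=> fE gE w w0; rewrite gE // fE ?conjC_eq0 // rmorphM fmorphV rmorphXn /=.
by rewrite -horner_map /= !conjCK.
Qed.

(** Conjugating both the argument and the value is the same as conjugating the
    coefficients of the numerator, an operation that commutes with [deriv_num]. *)
Lemma derive1n_conj k (f g : C -> C) (z : C) : laurent f ->
  (forall w, w != 0 -> g w = (f w^*)^*) -> z != 0 ->
  derive1n k g z = (derive1n k f z^*)^*.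
Proof.
move=> [N [p fE]] gE z0; elim: k N p f g fE gE => [|k IHk] N p f g fE gE.
  exact: gE.
(* The induction runs on the innermost derivative, hence the general f, g. *)
rewrite /derive1n !iterSr; apply: (IHk N.+1 (deriv_num N p)).
  exact: laurent_of_derive1.
move=> w w0; rewrite (laurent_of_derive1 (laurent_of_conj fE gE)) //.
rewrite (laurent_of_derive1 fE) ?conjC_eq0 //.
rewrite rmorphM fmorphV rmorphXn /= conjCK -horner_map /= conjCK.
by rewrite /deriv_num rmorphB rmorphM rmorphMn /= map_polyX deriv_map.
Qed.

(** Reversing the coefficients of the numerator clears the negative powers. *)
Lemma laurent_inv (f : C -> C) : laurent f -> laurent (fun z => f z^-1).
Proof.
move=> [N [p fE]].
exists (size p), ((\sum_(i < size p) p`_i *: 'X^(size p - i)) * 'X^N) => z z0.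
rewrite fE ?invr_eq0 // exprVn invrK horner_coef hornerM hornerXn mulrAC.
congr (_ * _); rewrite horner_sum mulr_suml; apply: eq_bigr => i _.
rewrite hornerZ hornerXn -mulrA; congr (_ * _); rewrite exprVn.
have /subnK le_is := ltnW (ltn_ord i); rewrite -[in X in _ / X]le_is exprD.
by rewrite invfM mulrA mulfV ?mul1r // expf_neq0.
Qed.

(** Pascal's rule: the product rule applied to each term of the Leibniz formula of
    order [k] gives the formula of order [k + 1]. *)
Lemma leibniz_step (A : comPzRingType) (u v : nat -> A) k :
  \sum_(i < k.+1) 'C(k, i)%:R * (u i * v (k - i).+1 + v (k - i)%N * u i.+1) =
  \sum_(i < k.+2) 'C(k.+1, i)%:R * u i * v (k.+1 - i)%N.
Proof.
rewrite [RHS]big_ord_recl bin0 subn0 mul1r.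
under eq_bigr do rewrite mulrDr.
under [in RHS]eq_bigr do rewrite binS natrD mulrDl mulrDl.
rewrite !big_split /= addrA; congr (_ + _).
  rewrite big_ord_recl bin0 subn0 mul1r big_ord_recr /= bin_small // !mul0r addr0.
  congr (_ + _); apply: eq_bigr => i _.
  by rewrite -subSn ?ltn_ord // mulrA.
by apply: eq_bigr => i _; rewrite [v _ * _]mulrC mulrA.
Qed.

Lemma leibniz k (f g : C -> C) (z : C) : laurent f -> laurent g -> z != 0 ->
  derive1n k (fun w => f w * g w) z =
  \sum_(i < k.+1) 'C(k, i)%:R * derive1n i f z * derive1n (k - i) g z.
Proof.
move=> Lf Lg; elim: k z => [|k IHk] z z0.
  by rewrite big_ord_recl big_ord0 addr0 bin0 mul1r.
pose h (i : 'I_k.+1) : C -> C :=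
  'C(k, i)%:R *: (derive1n i f * derive1n (k - i) g).
have -> : derive1n k.+1 (fun w => f w * g w) z = 'D_1 (\sum_(i < k.+1) h i) z.
  rewrite derive1nS derive1E; apply: near_eq_derive.
  near=> w; rewrite IHk; last by near: w; apply: near_neq0.
  by rewrite fct_sumE; apply: eq_bigr => i _; rewrite -mulrA.
have dh (i : 'I_k.+1) : is_derive z 1 (h i) _ := is_deriveZ 'C(k, i)%:R
  (is_deriveM (is_derive1n i Lf z0) (is_derive1n (k - i) Lg z0)).
have [_ ->] := is_derive_sum dh.
exact: (leibniz_step (fun i => derive1n i f z) (fun i => derive1n i g z)).
Unshelve. all: by end_near. Qed.

(** The counterpart of [leibniz_step] for [f (1 / z)], with the recurrence of [lah]
    in place of Pascal's rule; [u j] stands for the [j]-th derivative of [f] at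
    [1 / z]. *)
Lemma faa_di_bruno_inv_step (u : nat -> C) (z : C) k : z != 0 ->
  \sum_(j < k.+1) (-1) ^+ k * (lah k j)%:R *
     (z ^- (k + j) * (u j.+1 * - z ^- 2)
      + u j * - ((k + j)%:R * z ^- (k + j).+1)) =
  \sum_(j < k.+2) (-1) ^+ k.+1 * (lah k.+1 j)%:R * z ^- (k.+1 + j) * u j.
Proof.
move=> z0; rewrite [RHS]big_ord_recl mulr0 !mul0r add0r.
have zXV i : z ^- i = z^-1 ^+ i by rewrite exprVn.
(* The terms where the power of z is differentiated keep the derivative u j, the
   others have u j.+1. The former vanish for j = 0 and for j = k + 1, so their
   index may be shifted by one to match the latter. *)
pose t j := (-1) ^+ k.+1 * ((k + j) * lah k j)%:R * z ^- (k + j).+1 * u j.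
have t0 : t 0%N = 0 by rewrite /t; case: (k) => [|i]; rewrite ?muln0 mulr0 !mul0r.
have tk : t k.+1 = 0 by rewrite /t lah_small // muln0 mulr0 !mul0r.
have shift_t : \sum_(j < k.+1) t j = \sum_(j < k.+1) t j.+1.
  by rewrite big_ord_recl t0 add0r [RHS]big_ord_recr /= tk addr0.
rewrite (eq_bigr (fun j : 'I_k.+1 =>
  (-1) ^+ k.+1 * (lah k j)%:R * z ^- (k + j).+2 * u j.+1 + t j)); last first.
  by move=> j _; rewrite /t natrM !zXV !exprS expr0; ring.
rewrite big_split /= shift_t -big_split; apply: eq_bigr => j _ /=.
rewrite /t /bump /= add1n addSn !addnS natrD; ring.
Qed.

Lemma faa_di_bruno_inv k (f : C -> C) (z : C) : laurent f -> z != 0 ->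
  derive1n k (fun w => f w^-1) z =
  \sum_(j < k.+1) (-1) ^+ k * (lah k j)%:R * z ^- (k + j) * derive1n j f z^-1.
Proof.
move=> Lf; elim: k z => [|k IHk] z z0.
  by rewrite big_ord_recl big_ord0 addr0 expr0 invr1 !mul1r.
pose h (j : 'I_k.+1) : C -> C := ((-1) ^+ k * (lah k j)%:R) *:
  ((fun w => w ^- (k + j)) * (derive1n j f \o GRing.inv)).
have -> : derive1n k.+1 (fun w => f w^-1) z = 'D_1 (\sum_(j < k.+1) h j) z.
  rewrite derive1nS derive1E; apply: near_eq_derive.
  near=> w; rewrite IHk; last by near: w; apply: near_neq0.
  by rewrite fct_sumE; apply: eq_bigr => j _; rewrite -mulrA.
have zV0 : z^-1 != 0 by rewrite invr_eq0.
have dh (j : 'I_k.+1) : is_derive z 1 (h j) _ :=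
  is_deriveZ _ (is_deriveM (is_derive1_exprN (k + j) z0)
    (is_derive1_chain (g := GRing.inv) (x := z)
       (is_derive1n j Lf zV0) (is_derive1_inv z0))).
have [_ ->] := is_derive_sum dh.
exact: (faa_di_bruno_inv_step (fun j => derive1n j f z^-1)).
Unshelve. all: by end_near. Qed.
End OffZero.

(** * The mass term at the zeros *)

Lemma sum_antidiagonals (V : nmodType) (G : nat -> nat -> V) m :
  \sum_(l < m) \sum_(k < l.+1) G k (l - k)%N =
  \sum_(k < m) \sum_(p < m | (k + p < m)%N) G k p.
Proof.
transitivity (\sum_(l < m) \sum_(k < m | (k <= l)%N) G k (l - k)%N).
  apply: eq_bigr => l _.
  by rewrite (big_ord_widen _ (fun k => G k (l - k)%N) (ltn_ord l)).
rewrite (exchange_big_dep xpredT) //=; apply: eq_bigr => k _.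
transitivity (\sum_(k <= l < m) G k (l - k)%N); first by rewrite big_geq_mkord.
rewrite -{1}(add0n k) big_addn big_mkord.
rewrite (big_ord_widen _ (fun p => G k (p + k - k)%N) (leq_subr k m)).
by apply: eq_big => [p|p _]; rewrite ?addnK // ltn_subRL.
Qed.

Section Assembly.
Variable R : realType.
Local Notation C := (Cx R).

Lemma bell_mxE (z : C) m (p l : 'I_m) :
  bell_mx z m p l = (-1) ^+ p * (lah p l)%:R * z ^- (p + l).
Proof.
rewrite mxE; case: p l => [[|p] lt_p] [[|l] lt_l]; rewrite ?eqxx //.
- by rewrite !mul1r invr1.
- by rewrite lah_small // mulr0 mul0r.
- by rewrite [lah _ _]/= mulr0 mul0r.
rewrite [_ == _]/=; case: (leqP l.+1 p.+1) => [le_lp|lt_pl]; last first.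
  by rewrite (lah_small lt_pl) mulr0 mul0r.
by rewrite /bell -mulr_suml sum_partitions // mulrA.
Qed.

(** [bell_mx] is the change of basis from the derivatives of [f] at [1 / z] to
    those of [f (1 / w)] at [w = z]. *)
Lemma bell_mx_row (z : C) m (p : 'I_m) (f : C -> C) : laurent f -> z != 0 ->
  \sum_(l < m) bell_mx z m p l * derive1n l f z^-1 =
  derive1n p (fun w => f w^-1) z.
Proof.
move=> Lf z0; rewrite faa_di_bruno_inv //.
rewrite (big_ord_widen _ (fun l =>
  (-1) ^+ p * (lah p l)%:R * z ^- (p + l) * derive1n l f z^-1) (ltn_ord p)).
rewrite [RHS]big_mkcond; apply: eq_bigr => l _; rewrite bell_mxE /=.
by case: ltnP => // lt_pl; rewrite lah_small // mulr0 !mul0r.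
Qed.

Lemma derive1nMl k c (f : C -> C) (z : C) : laurent f -> z != 0 ->
  derive1n k (fun w => c * f w) z = c * derive1n k f z.
Proof.
move=> Lf; elim: k z => [//|k IHk] z z0.
rewrite derive1nS derive1E (@near_eq_derive _ _ _ _ (c *: derive1n k f)).
  by have [_ ->] := is_deriveZ c (is_derive1n k Lf z0).
by near=> w; rewrite IHk //; near: w; apply: near_neq0.
Unshelve. all: by end_near. Qed.

Lemma tensor_conj_delta k l (a b : C) (f g : C -> C) :
  laurent f -> laurent g -> a != 0 -> b != 0 ->
  tensor_conj (delta k a) (delta l b) (fun z1 z2 => f z1 * (g z2)^*) =
  (-1) ^+ (k + l) * (derive1n k f a * (derive1n l g b)^*).
Proof.
move=> Lf Lg a0 b0; rewrite /tensor_conj /delta.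
have -> : (fun z1 => ((-1) ^+ l *
      derive1n l (fun z2 => (f z1 * (g z2)^*)^*) b)^*) =
    (fun z1 => (-1) ^+ l * (derive1n l g b)^* * f z1).
  apply/funext => z1.
  have -> : (fun z2 => (f z1 * (g z2)^*)^*) = (fun z2 => (f z1)^* * g z2).
    by apply/funext => z2; rewrite rmorphM /= conjCK.
  rewrite derive1nMl // !rmorphM rmorphXn rmorphN rmorph1 /= conjCK.
  by rewrite -mulrA [f z1 * _]mulrC.
by rewrite derive1nMl // exprD -!mulrA [derive1n k f a * _]mulrC.
Qed.

Lemma reciprocal_conj_inv (M : C -> C) :
  reciprocal M = fun z => (fun w => (M w^*)^*) z^-1.
Proof. by apply/funext => z; rewrite /reciprocal fmorphV. Qed.

(** Moves the derivatives that [mass] takes at the reflected zero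
    [1 / conj z] to the point [1 / z] required by [bell_mx_row]. *)
Lemma derive1n_reciprocal_arg l (M : C -> C) (z : C) : laurent M -> z != 0 ->
  (derive1n l M (z^*)^-1)^* = derive1n l (fun w => (M w^*)^*) z^-1.
Proof.
by move=> LM z0; rewrite [RHS](@derive1n_conj _ _ M) ?invr_eq0 // fmorphV.
Qed.

Lemma laurent_conj (M : C -> C) : laurent M -> laurent (fun w => (M w^*)^*).
Proof.
move=> [N [p ME]]; exists N, (map_poly Num.conj p).
exact: (@laurent_of_conj _ N p M).
Qed.

Lemma fact_mxE m (A : 'M[C]_m) k l :
  (fact_mx R m *m A *m fact_mx R m) k l = (k`! * l`!)%:R * A k l.
Proof.
by rewrite mul_mx_diag mul_diag_mx !mxE natrM mulrAC.
Qed.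

(** The statement at a single zero. The factorials of [fact_mx] cancel the
    weights, [bell_mx] produces the derivatives of [g (1 / w)], and the Hankel
    matrix performs the Leibniz rule. *)
Lemma block_massE (z : C) m (xi : nat -> C) (f g : C -> C) :
  laurent f -> laurent g -> z != 0 ->
  \sum_(k < m) \sum_(l < m)
     (k`! * l`!)%:R^-1 *
     (fact_mx R m *m (hankel_mx xi m *m bell_mx z m) *m fact_mx R m) k l *
     (derive1n k f z * derive1n l g z^-1) =
  \sum_(l < m) xi l / l`!%:R * derive1n l (fun w => f w * g w^-1) z.
Proof.
move=> Lf Lg z0.
transitivity (\sum_(k < m) \sum_(p < m)
    hankel_mx xi m k p * derive1n k f z * derive1n p (fun w => g w^-1) z).
  apply: eq_bigr => k _.
  under [RHS]eq_bigr do rewrite -bell_mx_row // mulr_sumr.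
  rewrite exchange_big /=; apply: eq_bigr => l _.
  rewrite fact_mxE mulKf; last by rewrite pnatr_eq0 -lt0n muln_gt0 !fact_gt0.
  by rewrite mxE mulr_suml; apply: eq_bigr => p _; ring.
under [RHS]eq_bigr do
  rewrite (leibniz _ Lf (laurent_inv Lg) z0) mulr_sumr.
pose G k p := xi (k + p)%N / (k`! * p`!)%:R *
  derive1n k f z * derive1n p (fun w => g w^-1) z.
transitivity (\sum_(k < m) \sum_(p < m | (k + p < m)%N) G k p).
  apply: eq_bigr => k _; rewrite [RHS]big_mkcond; apply: eq_bigr => p _.
  by rewrite /G mxE; case: ifP; rewrite ?mul0r.
rewrite -sum_antidiagonals; apply: eq_bigr => l _; apply: eq_bigr => k _.
have le_kl : (k <= l)%N by rewrite -ltnS.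
rewrite /G subnKC // -(bin_fact le_kl) !natrM; field.
by rewrite !pnatr_eq0 -!lt0n !fact_gt0 bin_gt0 le_kl.
Qed.
End Assembly.

Theorem proposition22 (R : realType) (n d : nat) (Ln : Cx R)
    (zeta : 'I_d -> Cx R) (m : 'I_d -> nat) (L : Cx R -> Cx R)
    (Ln_neq0 : Ln != 0)
    (zeta_inj : injective zeta)
    (zeta_neq0 : forall i, zeta i != 0)
    (m_gt0 : forall i, (0 < m i)%N)
    (sum_m : (\sum_(i < d) m i = 2 * n)%N)
    (L_def : forall z, z != 0 ->
       L z = Ln * z ^- n * \prod_(i < d) (z - zeta i) ^+ m i)
    (xi : 'I_d -> nat -> Cx R)
    (M1 M2 : Cx R -> Cx R)
    (M1_laurent : laurent M1) (M2_laurent : laurent M2) :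
  mass zeta
    (\mxdiag_(i < d)
       (fact_mx R (m i) *m (hankel_mx (xi i) (m i) *m bell_mx (zeta i) (m i))
          *m fact_mx R (m i)))
    (fun z1 z2 => M1 z1 * (M2 z2)^*)
  = line_mass zeta m xi (fun z => M1 z * reciprocal M2 z).
Proof.
rewrite /mass /line_mass; apply: eq_bigr => i _.
rewrite (bigD1 i) //= [X in _ + X]big1 ?addr0 => [|j ne_ji]; last first.
  rewrite big1 // => k _; rewrite big1 // => l _.
  by rewrite /mxdiag mxblockK eq_sym (negPf ne_ji) mxE mulr0 mul0r.
rewrite submxblock_diag reciprocal_conj_inv.
have zi0 := zeta_neq0 i; have Lg := laurent_conj M2_laurent.
(* The signs in the definitions of mass and line_mass cancel those of delta. *)
have sqr_sign a : (-1) ^+ a * (-1) ^+ a = 1 :> Cx R.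
  by rewrite -expr2 sqrr_sign.
transitivity (\sum_(l < m i) xi i l / l`!%:R *
    derive1n l (fun w => M1 w * (M2 (w^-1)^*)^*) (zeta i)); last first.
  by apply: eq_bigr => l _; rewrite /delta; move: (sqr_sign l) => H; ring: H.
rewrite -(block_massE _ _ M1_laurent Lg zi0).
apply: eq_bigr => k _; apply: eq_bigr => l _.
rewrite tensor_conj_delta // ?invr_eq0 ?conjC_eq0 // derive1n_reciprocal_arg //.
by move: (sqr_sign (k + l)%N) => H; ring: H.
Qed.
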